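(* Let $k\ge 1$, let $\pi_\beta$ be a strictly positive, continuously differentiable density on $\mathbb{R}^k$ that is exponentially light, and suppose that $\pi_\beta$ satisfies either of the following conditions: (i) $\pi_\beta$ satisfies the curvature condition; or (ii) $|\nabla\log\pi_\beta(\beta)|$ is bounded as $|\beta|$ goes to infinity, i.e. there are $M,r<\infty$ with $|\nabla\log\pi_\beta(\beta)|\le M$ whenever $|\beta|>r$. Let $R\ge 0$ and $p>2$, define $f:[0,\infty)\to[0,\infty)$ by $f(x)=x$ for $x<R$ and $f(x)=x+(x-R)^p$ for $x\ge R$, and define $h:\mathbb{R}^k\to\mathbb{R}^k$ by $h(\gamma)=f(|\gamma|)\,\gamma/|\gamma|$ for $\gamma\ne 0$ and $h(0)=0$. Then the density $$\pi_\gamma(\gamma)=\pi_\beta\bigl(h(\gamma)\bigr)\,\bigl|\det\nabla h(\gamma)\bigr|,\qquad \gamma\in\mathbb{R}^k,$$ satisfies the curvature condition.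
   Context: $|\cdot|$ denotes the Euclidean norm on $\mathbb{R}^k$, and $\cdot$ between vectors the inner product. Densities are with respect to Lebesgue measure. $\nabla h(\gamma)$ is the Jacobian matrix of $h$. A strictly positive continuously differentiable density $\pi$ on $\mathbb{R}^k$ is exponentially light if $$\limsup_{|x|\to\infty}\frac{x}{|x|}\cdot\nabla\log\pi(x)<0$$ (the value $-\infty$ is allowed), and $\pi$ satisfies the curvature condition if $$\limsup_{|x|\to\infty}\frac{x}{|x|}\cdot\frac{\nabla\pi(x)}{|\nabla\pi(x)|}<0.$$ *)

(* Defs.v *)
From HB Require Import structures.
From mathcomp Require Import all_boot all_order all_algebra.
From mathcomp Require Import all_classical all_reals all_analysis.

Set Implicit Arguments.
Unset Strict Implicit.
Unset Printing Implicit Defensive.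

Import Order.TTheory GRing.Theory Num.Theory.
Import numFieldNormedType.Exports.

Local Open Scope classical_set_scope.
Local Open Scope ring_scope.

Section lebesgue_cons.
Context {R : realType} (n : nat).
Local Notation RR := (measurableTypeR R).
Variable mu : {sigma_finite_measure set (n.-tuple RR) -> \bar R}.
Local Open Scope ereal_scope.

Let ucons (p : RR * n.-tuple RR) : n.+1.-tuple RR := [tuple of p.1 :: p.2].

Let uncons (t : n.+1.-tuple RR) : RR * n.-tuple RR :=
  (thead t, [tuple of behead t]).

Let measurable_ucons : measurable_fun setT ucons.
Proof. exact: measurable_cons. Qed.

Let measurable_uncons : measurable_fun setT uncons.
Proof.
apply/measurable_fun_pairP; split; first exact: measurable_tnth.
exact: measurable_behead.
Qed.

Let uconsK : cancel ucons uncons.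
Proof. by case=> x t; congr pair; apply/val_inj. Qed.

(* As (x, t) |-> x :: t is an isomorphism of measurable spaces, this is the
   product measure of lebesgue_measure and mu, carried over to tuples. *)
Definition lebesgue_cons : set (n.+1.-tuple RR) -> \bar R :=
  pushforward (@lebesgue_measure R \x mu) ucons.

Let lebesgue_cons0 : lebesgue_cons set0 = 0.
Proof. by rewrite /lebesgue_cons /pushforward preimage_set0 measure0. Qed.

Let lebesgue_cons_ge0 A : 0 <= lebesgue_cons A.
Proof. exact: measure_ge0. Qed.

Let lebesgue_cons_sigma_additive : semi_sigma_additive lebesgue_cons.
Proof.
move=> F mF tF mUF; rewrite /lebesgue_cons /pushforward preimage_bigcup.
apply: measure_semi_sigma_additive.
- by move=> i; rewrite -[X in measurable X]setTI; exact: measurable_ucons.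
- apply/trivIsetP => /= i j _ _ ij; rewrite -preimage_setI.
  by move/trivIsetP : tF => /(_ _ _ _ _ ij) ->//; rewrite preimage_set0.
- rewrite -preimage_bigcup -[X in measurable X]setTI.
  exact: measurable_ucons.
Qed.

HB.instance Definition _ := isMeasure.Build _ _ _ lebesgue_cons
  lebesgue_cons0 lebesgue_cons_ge0 lebesgue_cons_sigma_additive.

Let lebesgue_cons_sigma_finite : sigma_finite setT lebesgue_cons.
Proof.
have /sigma_finiteP[F [FT ndF Foo]] := sigma_finiteT (@lebesgue_measure R).
have /sigma_finiteP[G [GT ndG Goo]] := sigma_finiteT mu.
have uconsFG i : ucons @^-1` (uncons @^-1` (F i `*` G i)) = F i `*` G i.
  by apply/funext => p; rewrite /preimage /mkset uconsK.
exists (fun i => uncons @^-1` (F i `*` G i)) => [|i].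
  rewrite -preimage_bigcup -(preimage_setT uncons); congr (_ @^-1` _).
  apply/seteqP; split=> // -[x t] _.
  have [i _ Fx] : (\bigcup_i F i) x by rewrite -FT.
  have [j _ Gt] : (\bigcup_i G i) t by rewrite -GT.
  exists (maxn i j) => //; split => /=.
    by move: x Fx; exact/subsetPset/ndF/leq_maxl.
  by move: t Gt; exact/subsetPset/ndG/leq_maxr.
have [mF Fioo] := Foo i; have [mG Gioo] := Goo i; split.
  rewrite -[X in measurable X]setTI; apply: measurable_uncons => //.
  exact: measurableX.
rewrite /lebesgue_cons /pushforward uconsFG product_measure1E//.
by rewrite lte_mul_pinfty// ge0_fin_numE.
Qed.

HB.instance Definition _ := Measure_isSigmaFinite.Build _ _ _ lebesgue_cons
  lebesgue_cons_sigma_finite.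

End lebesgue_cons.

(* Lebesgue measure on R^k, the points of R^k being k-tuples with the product
   (that is, Borel) sigma-algebra. *)
Fixpoint lebesgue_tuple (R : realType) (k : nat) :
    {sigma_finite_measure set (k.-tuple (measurableTypeR R)) -> \bar R} :=
  if k is k'.+1 then lebesgue_cons (lebesgue_tuple R k') else \d_[tuple].

Lemma lebesgue_tuple_box (R : realType) (k : nat)
    (A : 'I_k -> set (measurableTypeR R)) : (forall i, measurable (A i)) ->
  (lebesgue_tuple R k [set t | forall i, A i (tnth t i)] =
   \prod_(i < k) lebesgue_measure (A i))%E.
Proof.
elim: k A => [|k IH] A mA.
  by rewrite big_ord0 /= diracE mem_set// => -[].
rewrite big_ord_recl -IH//= /lebesgue_cons /pushforward.
rewrite -product_measure1E//.
  congr (product_measure1 _ _ _); apply/seteqP; split=> [[x t]|[x t] [Ax At] i] /=.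
    by move=> At; split=> [|i]; [exact: (At ord0)|have := At (lift ord0 i); rewrite tnthS].
  by case: (unliftP ord0 i) => [j ->|->]; [rewrite tnthS; exact: At|exact: Ax].
rewrite (_ : [set t | _] =
    \bigcap_(i in [set: 'I_k]) ((@tnth k _)^~ i @^-1` A (lift ord0 i))); last first.
  by apply/seteqP; split=> t At i; [move=> _|]; exact: At.
apply: fin_bigcap_measurable => // i _.
by rewrite -[X in measurable X]setTI; exact: measurable_tnth.
Qed.


Section euclidean.
Context {R : realType} {k : nat}.
Implicit Types (x y : 'rV[R]_k) (g : 'rV[R]_k -> R).

Definition dotp x y : R := \sum_(i < k) x 0 i * y 0 i.

(* The library norm `|x| on 'rV[R]_k is the sup norm; it yields the same
   topology and the same notion of differentiability as enorm. *)
Definition enorm x : R := Num.sqrt (dotp x x).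

Definition grad g x : 'rV[R]_k := \row_i 'D_(delta_mx 0 i) g x.

Definition continuously_differentiable g : Prop :=
  (forall x, differentiable g x) /\ continuous (grad g).

Definition row_of_tuple (t : k.-tuple (measurableTypeR R)) : 'rV[R]_k :=
  \row_i tnth t i.

Definition is_density g : Prop :=
  [/\ forall x, 0 <= g x,
      measurable_fun [set: k.-tuple (measurableTypeR R)] (g \o row_of_tuple) &
      (\int[lebesgue_tuple R k]_t (g (row_of_tuple t))%:E = 1)%E].

(* The filter |x| -> +oo. *)
Definition enorm_pinfty : set_system 'rV[R]_k :=
  filter_from [set: R] (fun r => [set x | r < enorm x]).

Definition exponentially_light g : Prop :=
  (limf_esup (fun x =>
     (dotp ((enorm x)^-1 *: x) (grad (@ln R \o g) x))%:E) enorm_pinfty < 0)%E.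

(* As 0^-1 = 0, the inner product is 0 where the gradient of g vanishes, so the
   condition forces this gradient to be nonzero near infinity. *)
Definition curvature_condition g : Prop :=
  (limf_esup (fun x =>
     (dotp ((enorm x)^-1 *: x) ((enorm (grad g x))^-1 *: grad g x))%:E)
     enorm_pinfty < 0)%E.

Definition log_gradient_bounded_at_infinity g : Prop :=
  exists M r : R, forall x, r < enorm x -> enorm (grad (@ln R \o g) x) <= M.

Definition radial_profile (R0 p s : R) : R :=
  if s < R0 then s else s + (s - R0) `^ p.

Definition radial_map (f : R -> R) x : 'rV[R]_k :=
  if x == 0 then 0 else (f (enorm x) / enorm x) *: x.

(* 'J acts on row vectors, so it is the transpose of the usual Jacobian matrix;
   the determinant is unaffected. *)
Definition transformed_density (h : 'rV[R]_k -> 'rV[R]_k) g x : R :=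
  g (h x) * `|\det ('J h x)|.

End euclidean.

(* Main.v *)
From HB Require Import structures.
Require Import Defs.
From mathcomp Require Import all_boot all_order all_algebra.
From mathcomp Require Import all_classical all_reals all_analysis.
From mathcomp Require Import ring lra.

Set Implicit Arguments.
Unset Strict Implicit.
Unset Printing Implicit Defensive.

Import Order.TTheory GRing.Theory Num.Theory.
Import numFieldNormedType.Exports.

Local Open Scope classical_set_scope.
Local Open Scope ring_scope.

(** Write [f s = s * (1 + a s)] for the radial profile, so that
    [h x = (1 + a |x|) x].  Everything rests on three facts.

    Regularity.  Since [p > 2], the functions [a] and [f'] are C1 on the whole
    line, with derivatives that vanish at [0].  The vanishing is what makes
    [phi o |.|] C1 across the origin, where [|.|] itself is not differentiable
    ([has_grad_radial], [radial_map_continuous]); its gradient at [x] is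
    [phi' |x| * x / |x|], that is [radial_map phi' x].

    Jacobian.  The differential of [h] at [x] is [1 + a |x|] times the identity
    plus a rank one matrix, hence with [s = |x|]
    [det (J h x) = (1 + a s) ^ (k - 1) * f' s] ([det_jacobian_radial]), a
    positive radial function [D s].  So [pi_gamma x = pi_beta (h x) * D |x|] is
    positive and C1 ([continuously_differentiable_transformed_density]).

    Curvature.  Let [G] be the gradient of [pi_beta] at [h x], [P] the value
    of [pi_beta] there, and [u = x / |x|], which is also the direction of
    [h x].  Then
    [grad pi_gamma x = D (c G + (f' - c) (u . G) u) + P D' u],
    where [c = 1 + a s <= f' s].  Lightness says [u . G <= - eps P] far away,
    and the curvature condition says [u . G <= - delta |G|]; if instead
    [|G| <= M P], the latter follows from lightness with [delta = eps / M], so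
    both alternatives reduce to the same one ([log_gradient_bounded_radial]).
    The transformation multiplies the radial part of [G] by [f'] and the
    tangential part by the smaller factor [c], so it can only turn the
    gradient inwards; the extra term [P D' u] points outwards, but
    [D' = o(D f')] ([dradial_det_le]) while [P <= |G| / eps], so it is
    negligible with respect to [D f' |G|].  Up to such terms [u . grad pi_gamma]
    is at most [- delta D f' |G|] and [|grad pi_gamma|] is at most [D f' |G|];
    [radial_curvature_le] carries out this computation. *)

(** * The Euclidean inner product and norm *)

Section euclidean_space.
Context {R : realType} {k : nat}.
Implicit Types (x y z u v : 'rV[R]_k) (c t : R).

Lemma dotpC x y : dotp x y = dotp y x.
Proof. by apply: eq_bigr => i _; rewrite mulrC. Qed.

Lemma dotpDl x y z : dotp (x + y) z = dotp x z + dotp y z.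
Proof.
by rewrite /dotp -big_split; apply: eq_bigr => i _; rewrite mxE mulrDl.
Qed.

Lemma dotpZl c x y : dotp (c *: x) y = c * dotp x y.
Proof.
by rewrite /dotp mulr_sumr; apply: eq_bigr => i _; rewrite mxE mulrA.
Qed.

Lemma dotpDr x y z : dotp x (y + z) = dotp x y + dotp x z.
Proof. by rewrite dotpC dotpDl !(dotpC x). Qed.

Lemma dotpZr c x y : dotp x (c *: y) = c * dotp x y.
Proof. by rewrite dotpC dotpZl dotpC. Qed.

Lemma dotp0r x : dotp x 0 = 0.
Proof. by rewrite -(scale0r 0) dotpZr mul0r. Qed.

Lemma dotp_delta x i : dotp x (delta_mx 0 i) = x 0 i.
Proof.
rewrite /dotp (bigD1 i)//= mxE !eqxx mulr1 big1 ?addr0// => j ji.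
by rewrite mxE (negbTE ji) andbF mulr0.
Qed.

Lemma dotpxx_ge0 x : 0 <= dotp x x.
Proof. by apply: sumr_ge0 => i _; rewrite -expr2 sqr_ge0. Qed.

Lemma enorm_ge0 x : 0 <= enorm x.
Proof. exact: sqrtr_ge0. Qed.

Lemma dotpxx x : dotp x x = enorm x ^+ 2.
Proof. by rewrite sqr_sqrtr// dotpxx_ge0. Qed.

Lemma enorm_eq0 x : (enorm x == 0) = (x == 0).
Proof.
apply/eqP/eqP => [x0|->]; last by rewrite /enorm dotp0r sqrtr0.
have /eqP : dotp x x = 0 by rewrite dotpxx x0 expr0n.
rewrite psumr_eq0 => [/allP/= xx|i _]; last by rewrite -expr2 sqr_ge0.
apply/rowP => i; rewrite mxE; apply/eqP.
by have := xx i (mem_index_enum i); rewrite mulf_eq0 orbb.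
Qed.

Lemma enorm0 : enorm (0 : 'rV[R]_k) = 0.
Proof. by apply/eqP; rewrite enorm_eq0. Qed.

Lemma enorm_gt0 x : (0 < enorm x) = (x != 0).
Proof. by rewrite lt_neqAle eq_sym enorm_eq0 enorm_ge0 andbT. Qed.

Lemma enormZ c x : enorm (c *: x) = `|c| * enorm x.
Proof.
by rewrite /enorm dotpZl dotpZr mulrA -expr2 sqrtrM ?sqr_ge0// sqrtr_sqr.
Qed.

(** The Cauchy-Schwarz inequality, from the nonnegativity of the squared norm
    of [(y . y) x - (x . y) y]. *)
Lemma dotp_le_enorm x y : `|dotp x y| <= enorm x * enorm y.
Proof.
have [->|y0] := eqVneq y 0; first by rewrite dotp0r normr0 enorm0 mulr0.
rewrite -(ler_pXn2r (n := 2)) ?nnegrE ?mulr_ge0 ?enorm_ge0//.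
rewrite exprMn real_normK ?num_real// -!dotpxx.
have yy : 0 < dotp y y by rewrite dotpxx exprn_gt0// enorm_gt0.
have := dotpxx_ge0 (dotp y y *: x + (- dotp x y) *: y).
rewrite !(dotpDl, dotpDr, dotpZl, dotpZr) (dotpC y x).
set a := dotp x x; set b := dotp x y; set d := dotp y y => H.
have {H} : 0 <= d * (a * d - b ^+ 2).
  by rewrite (le_trans H)// [leLHS](_ : _ = d * (a * d - b ^+ 2))//; ring.
by rewrite pmulr_rge0// subr_ge0.
Qed.

Lemma enormD x y : enorm (x + y) <= enorm x + enorm y.
Proof.
rewrite -(ler_pXn2r (n := 2)) ?nnegrE ?addr_ge0 ?enorm_ge0//.
rewrite -dotpxx dotpDl !dotpDr !dotpxx (dotpC y x).
have := le_trans (ler_norm _) (dotp_le_enorm x y).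
set a := enorm x; set b := enorm y; set d := dotp x y => H.
have -> : (a + b) ^+ 2 = a ^+ 2 + b ^+ 2 + (a * b) *+ 2 by ring.
lra.
Qed.

Lemma coord_le_mx_norm x i : `|x 0 i| <= `|x|.
Proof.
rewrite [leRHS]mx_normrE.
by apply: (le_bigmax _ (fun ij : 'I_1 * 'I_k => `|x ij.1 ij.2|) (0, i)).
Qed.

Lemma enorm_le_mx_norm x : enorm x <= Num.sqrt k%:R * `|x|.
Proof.
rewrite -[`|x|]normr_id -sqrtr_sqr -sqrtrM ?ler0n// ler_wsqrtr//.
rewrite mulr_natl -[X in _ *+ X]card_ord -sumr_const ler_sum// => i _.
rewrite -expr2 -real_normK ?num_real// ler_pXn2r ?nnegrE//.
exact: coord_le_mx_norm.
Qed.

Lemma mx_norm_le_enorm x : `|x| <= enorm x.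
Proof.
rewrite [leLHS]mx_normrE; apply: bigmax_le => [|[i j] _ /=].
  exact: enorm_ge0.
rewrite ord1 -sqrtr_sqr ler_wsqrtr// /dotp (bigD1 j)//= -expr2 lerDl.
by apply: sumr_ge0 => l _; rewrite -expr2 sqr_ge0.
Qed.

Lemma dotp_continuous (F G : 'rV[R]_k -> 'rV[R]_k) :
  continuous F -> continuous G -> continuous (fun x => dotp (F x) (G x)).
Proof.
move=> cF cG x; rewrite /dotp.
apply: (cvg_big add_continuous (nbhs_filter x)) => i _.
apply: cvgM.
- exact: (continuous_comp (cF x) (@coord_continuous R 1 k 0 i (F x))).
- exact: (continuous_comp (cG x) (@coord_continuous R 1 k 0 i (G x))).
Qed.

Lemma enorm_continuous : continuous (@enorm R k).
Proof.
move=> x; apply: (@continuous_comp _ _ _ (fun x => dotp x x)).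
  by apply: dotp_continuous => y; exact: cvg_id.
exact: sqrt_continuous.
Qed.

End euclidean_space.

(** * Gradients *)

Section gradient_calculus.
Context {R : realType} {k : nat}.
Implicit Types (x u v G : 'rV[R]_k) (f g : 'rV[R]_k -> R).

(** Differentiability at [x] and the value of the gradient in one statement, so
    that both are carried through the rules of calculus at once. *)
Definition has_grad g x G := is_diff x g (dotp G).

Lemma has_grad_differentiable g x G : has_grad g x G -> differentiable g x.
Proof. by case. Qed.

Lemma has_grad_diff g x G v : has_grad g x G -> 'd g x v = dotp G v.
Proof. by case=> _ ->. Qed.

Lemma has_gradE g x G : has_grad g x G -> grad g x = G.
Proof.
move=> gG; apply/rowP => i; rewrite mxE deriveE.
  by rewrite (has_grad_diff _ gG) dotp_delta.
exact: has_grad_differentiable gG.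
Qed.

Lemma differentiable_has_grad g x :
  differentiable g x -> has_grad g x (grad g x).
Proof.
move=> dg; apply: DiffDef => //; apply/funext => v.
rewrite [in LHS](row_sum_delta v) linear_sum /dotp; apply: eq_bigr => i _.
by rewrite linearZ mxE deriveE// mulrC.
Qed.

Lemma continuously_differentiable_has_grad g (dg : 'rV[R]_k -> 'rV[R]_k) :
  (forall x, has_grad g x (dg x)) -> continuous dg ->
  continuously_differentiable g.
Proof.
move=> gdg cdg; split=> [x|]; first exact: has_grad_differentiable (gdg x).
by rewrite (_ : grad g = dg)//; apply/funext => x; exact: has_gradE.
Qed.

Lemma has_gradD f g x F G :
  has_grad f x F -> has_grad g x G -> has_grad (f + g) x (F + G).
Proof.
move=> fF gG; apply: is_diff_eq; first exact: (is_diffD fF gG).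
by apply/funext => v; rewrite dotpDl.
Qed.

Lemma has_gradM f g x F G : has_grad f x F -> has_grad g x G ->
  has_grad (f * g) x (f x *: G + g x *: F).
Proof.
move=> fF gG; apply: is_diff_eq; first exact: (is_diffM fF gG).
by apply/funext => v; rewrite dotpDl !dotpZl.
Qed.

Lemma has_grad_sum n (f : 'I_n -> 'rV[R]_k -> R) x (F : 'I_n -> 'rV[R]_k) :
  (forall i, has_grad (f i) x (F i)) ->
  has_grad (\sum_i f i) x (\sum_i F i).
Proof.
move=> fF; elim/big_ind2 : _ => // [|? ? ? ?]; last exact: has_gradD.
rewrite /has_grad (_ : dotp 0 = 0); first exact: (is_diff_cst (0 : R) x).
by apply/funext => v; rewrite dotpC dotp0r.
Qed.

Fact dotp_is_linear u : linear (dotp u : 'rV[R]_k -> R^o).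
Proof. by move=> a v w; rewrite dotpDr dotpZr. Qed.

HB.instance Definition _ u :=
  GRing.isLinear.Build R 'rV[R]_k R^o _ (dotp u) (dotp_is_linear u).

Lemma dotpr_continuous u : continuous (dotp u).
Proof.
by apply: (@dotp_continuous R k (cst u) id) => y;
  [exact: cst_continuous|exact: cvg_id].
Qed.

Lemma has_grad_dotp u x : has_grad (dotp u) x u.
Proof.
apply: DiffDef; first exact/linear_differentiable/dotpr_continuous.
exact/diff_lin/dotpr_continuous.
Qed.

Lemma has_grad_coord x i : has_grad (fun y => y 0 i) x (delta_mx 0 i).
Proof.
have -> : (fun y => y 0 i) = dotp (delta_mx 0 i) :> ('rV[R]_k -> R).
  by apply/funext => y; rewrite dotpC dotp_delta.
exact: has_grad_dotp.
Qed.

Lemma is_derive_diff (phi : R -> R) (s d : R) :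
  is_derive s 1 phi d -> is_diff s phi ( *%R^~ d).
Proof.
move=> phid; have dphi : differentiable phi s by apply/derivable1_diffP.
apply: DiffDef => //; rewrite diff1E//; apply/funext => t /=.
by rewrite derive1E derive_val.
Qed.

Lemma has_grad_comp1 (phi : R -> R) g x (d : R) G :
  is_derive (g x) 1 phi d -> has_grad g x G -> has_grad (phi \o g) x (d *: G).
Proof.
move=> /is_derive_diff phid gG.
apply: is_diff_eq; first exact: (is_diff_comp gG phid).
by apply/funext => v; rewrite dotpZl /= mulrC.
Qed.

Lemma has_grad_enorm x : x != 0 -> has_grad (@enorm R k) x ((enorm x)^-1 *: x).
Proof.
move=> x0; rewrite [X in has_grad X](_ : _ =
    Num.sqrt \o (\sum_i ((fun y : 'rV[R]_k => y 0 i) * (fun y => y 0 i))));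
  last first.
  apply/funext => y /=; rewrite fct_sumE.
  by congr Num.sqrt; apply: eq_bigr.
have x2 : (\sum_i ((fun y : 'rV[R]_k => y 0 i) * (fun y => y 0 i))) x =
    enorm x ^+ 2.
  by rewrite -dotpxx fct_sumE.
have -> : (enorm x)^-1 *: x = (2 * Num.sqrt (enorm x ^+ 2))^-1 *:
    \sum_i (x 0 i *: delta_mx 0 i + x 0 i *: delta_mx 0 i).
  rewrite big_split/= -row_sum_delta sqrtr_sqr ger0_norm ?enorm_ge0//.
  rewrite -(mulr2n x) -[x *+ 2]scaler_nat scalerA invfM mulrAC.
  by rewrite mulVf ?pnatr_eq0// mul1r.
apply: has_grad_comp1.
  rewrite -x2; apply: is_derive1_sqrt.
  by rewrite x2 exprn_gt0// enorm_gt0.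
apply: has_grad_sum => i.
exact: has_gradM (has_grad_coord x i) (has_grad_coord x i).
Qed.

Lemma is_derive_littleo (phi : R -> R) : is_derive (0 : R) 1 phi 0 ->
  forall e : R, 0 < e -> \forall t \near (0 : R), `|phi t - phi 0| <= e * `|t|.
Proof.
move=> phi0 e e0.
have /diff_locally dphi : differentiable phi (0 : R) by apply/derivable1_diffP.
move: dphi; rewrite (@diff_val _ _ _ _ _ _ _ (is_derive_diff phi0)).
move=> /eqaddoP/(_ e e0); apply: filterS => t /=.
by rewrite !fctE /= !addr0 mulr0 addr0.
Qed.

(** At the origin [enorm] is not differentiable, but [phi \o enorm] is: as
    [phi' 0 = 0], it is constant there up to [o(enorm y)], and [enorm] is
    bounded by a multiple of the sup norm. *)
Lemma has_grad_radial (phi psi : R -> R) x :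
  is_derive (enorm x) 1 phi (psi (enorm x)) -> psi 0 = 0 ->
  has_grad (phi \o @enorm R k) x (radial_map psi x).
Proof.
move=> phipsi psi0; rewrite /radial_map; have [x0|x0] := eqVneq x 0; last first.
  by rewrite -scalerA; apply: has_grad_comp1 => //; exact: has_grad_enorm.
subst x; move: phipsi; rewrite enorm0 psi0 => dphi.
have lo : (phi \o @enorm R k) \o shift 0 =
    cst ((phi \o @enorm R k) 0) + dotp 0 +o_ (0 : 'rV[R]_k) id.
  apply/eqaddoP => e e0.
  pose C : R := Num.sqrt k%:R + 1.
  have C0 : 0 < C by rewrite ltr_wpDl// sqrtr_ge0.
  have := @is_derive_littleo phi dphi (e / C) (divr_gt0 e0 C0).
  move=> near_phi.
  have := @enorm_continuous R k 0; rewrite /continuous_at enorm0.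
  move=> /(_ _ near_phi) near_phi_enorm.
  have : \forall y \near (0 : 'rV[R]_k),
    `|phi (enorm y) - phi 0| <= e / C * `|enorm y| by exact: near_phi_enorm.
  apply: filterS => y /= Hy.
  rewrite !fctE /= addr0 enorm0 dotpC dotp0r addr0.
  rewrite (le_trans Hy)// ger0_norm ?enorm_ge0//.
  rewrite -mulrA ler_pM2l// ler_pdivrMl// (le_trans (enorm_le_mx_norm _))//.
  by rewrite ler_wpM2r// lerDl.
apply: DiffDef; last exact: (diff_unique (@dotpr_continuous 0) lo).
apply/diff_locallyP; rewrite (diff_unique (@dotpr_continuous 0) lo).
by split => //; exact: dotpr_continuous.
Qed.

(** No case distinction is needed: at the origin the scaled vector is [0]. *)
Lemma radial_mapE (psi : R -> R) x :
  radial_map psi x = (psi (enorm x) / enorm x) *: x.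
Proof. by rewrite /radial_map; case: eqVneq => // ->; rewrite scaler0. Qed.

(** Continuity at the origin comes from [enorm (radial_map psi y)] being
    [`|psi (enorm y)|] for [y != 0], although the direction of [y] has no limit
    there. *)
Lemma radial_map_continuous (psi : R -> R) :
  continuous psi -> psi 0 = 0 -> continuous (@radial_map R k psi).
Proof.
move=> cpsi psi0 x; rewrite /continuous_at.
have Fx := nbhs_filter x.
have [->|x0] := eqVneq x 0.
  rewrite {2}/radial_map eqxx.
  apply/(cvgr0Pnorm_le (FF := nbhs_filter _)) => e e0.
  have /cvgr0Pnorm_le/(_ e e0) near_psi : psi s @[s --> (0 : R)] --> (0 : R).
    by rewrite -[X in _ --> X]psi0; exact: cpsi.
  have := @enorm_continuous R k 0; rewrite /continuous_at enorm0.
  move=> /(_ _ near_psi) near_psi_enorm.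
  have : \forall y \near (0 : 'rV[R]_k), `|psi (enorm y)| <= e.
    exact: near_psi_enorm.
  apply: filterS => y /= Hy; rewrite (le_trans (mx_norm_le_enorm _))//.
  rewrite radial_mapE; have [->|y0] := eqVneq y 0.
    by rewrite scaler0 enorm0 ltW.
  rewrite enormZ normrM normfV (ger0_norm (enorm_ge0 y)) divfK//.
  by rewrite enorm_eq0.
rewrite radial_mapE (funext (radial_mapE psi)).
apply: cvgZ; last exact: cvg_id.
apply: cvgM.
  exact: (continuous_comp (@enorm_continuous R k x) (cpsi (enorm x))).
by apply: cvgV; [rewrite enorm_eq0|exact: enorm_continuous].
Qed.

Lemma is_diff_row m (h dh : 'rV[R]_k -> 'rV[R]_m) x :
  (forall j, is_diff x (fun y => h y 0 j) (fun v => dh v 0 j)) ->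
  is_diff x h dh.
Proof.
move=> hdh.
have dfh : differentiable h x.
  rewrite (_ : h = \sum_j (fun y => h y 0 j *: delta_mx 0 j)).
    apply: differentiable_sum => j; apply: differentiableZl.
    by case: (hdh j).
  by apply/funext => y; rewrite fct_sumE [LHS]row_sum_delta.
apply: DiffDef => //; apply/funext => v; apply/rowP => j.
have <- : 'd (fun y => h y 0 j) x v = dh v 0 j by case: (hdh j) => _ ->.
rewrite -(deriveE _ dfh) -deriveE; last by case: (hdh j).
by rewrite derive_mx ?mxE//; exact: diff_derivable.
Qed.

Lemma is_diff_scale_id g x G : has_grad g x G ->
  is_diff x (fun y => g y *: y) (fun v => g x *: v + dotp G v *: x).
Proof.
move=> gG; apply: is_diff_row => j.
have := has_gradM gG (has_grad_coord x j).
rewrite /has_grad (_ : g * _ = (fun y => (g y *: y) 0 j)); last first.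
  by apply/funext => y; rewrite mxE.
move=> H; apply: (is_diff_eq H).
apply/funext => v.
by rewrite dotpDl !dotpZl (dotpC _ v) dotp_delta !mxE (mulrC (x 0 j)).
Qed.

Lemma jacobian_scale_id g x G : has_grad g x G ->
  'J (fun y => g y *: y) x = (g x)%:M + G^T *m x.
Proof.
move=> /is_diff_scale_id[_ dh]; apply/row_matrixP => i.
rewrite !rowE mul_rV_lin1 dh mulmxDr mul_mx_scalar.
rewrite dotp_delta mulmxA; congr (_ + _).
by apply/rowP => j; rewrite -rowE !mxE big_ord1 !mxE.
Qed.

Lemma has_grad_comp_scale_id f g x F G :
  has_grad g x G -> has_grad f (g x *: x) F ->
  has_grad (fun y => f (g y *: y)) x (g x *: F + dotp x F *: G).
Proof.
move=> /is_diff_scale_id dh fF.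
apply: (is_diff_eq (is_diff_comp dh fF)).
apply/funext => v /=.
by rewrite dotpDr dotpDl !dotpZr !dotpZl (dotpC F x) [X in _ + X]mulrC.
Qed.

End gradient_calculus.

(** The matrix determinant lemma: the block matrix [A] below has two block
    triangular factorizations, one through each of its Schur complements; the
    second one is [1 + c^-1 * (v *m u) 0 0], of size one. *)
Lemma det_scalar_add_rank1 (F : fieldType) (k : nat) (c : F) (u : 'cV[F]_k)
    (v : 'rV[F]_k) : (0 < k)%N -> c != 0 ->
  \det (c%:M + u *m v) = c ^+ k.-1 * (c + (v *m u) 0 0).
Proof.
move=> k0 c0.
pose A := block_mx 1%:M v (- u) c%:M.
have detA1 : \det A = \det (c%:M + u *m v).
  have -> : A = block_mx 1%:M 0 (- u) 1%:M *m block_mx 1%:M v 0 (c%:M + u *m v).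
    rewrite mulmx_block !mul1mx !mulmx1 !mul0mx !addr0; congr block_mx.
    by rewrite mulNmx addrCA addNr addr0.
  by rewrite det_mulmx det_lblock det_ublock !det1 !mul1r.
have detA2 : \det A = c ^+ k * (1 + c^-1 * (v *m u) 0 0).
  have -> : A = block_mx (1%:M + c^-1 *: (v *m u)) (c^-1 *: v) 0 1%:M *m
      block_mx 1%:M 0 (- u) c%:M.
    rewrite mulmx_block !mulmx1 !mul1mx !mul0mx ?mulmx0 ?add0r ?addr0.
    congr block_mx.
      by rewrite mulmxN -scalemxAl addrK.
    by rewrite mul_mx_scalar scalerA mulfV// scale1r.
  rewrite det_mulmx det_ublock det_lblock !det1 mulr1 mul1r det_scalar mulrC.
  by rewrite det_mx11 !mxE.
have -> : \det (c%:M + u *m v) = c ^+ k.-1 * c * (1 + c^-1 * (v *m u) 0 0).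
  by rewrite -detA1 detA2 -exprSr prednK.
rewrite -mulrA mulrDr mulr1.
by rewrite mulrA mulfV// mul1r.
Qed.

(** * Powers of the positive part *)

Section positive_part_power.
Context {R : realType}.
Implicit Types q s : R.

Definition pospow q s : R := Num.max 0 s `^ q.

Lemma pospow_le0 q s : 0 < q -> s <= 0 -> pospow q s = 0.
Proof. by move=> q0 s0; rewrite /pospow max_l// powR0// gt_eqF. Qed.

Lemma pospow_ge0E q s : 0 <= s -> pospow q s = s `^ q.
Proof. by move=> s0; rewrite /pospow max_r. Qed.

Lemma pospow_ge0 q s : 0 <= pospow q s.
Proof. exact: powR_ge0. Qed.

Lemma mulr_pospowB1 q s : 1 < q -> s * pospow (q - 1) s = pospow q s.
Proof.
move=> q1; have [s0|/ltW s0] := leP s 0.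
  by rewrite !pospow_le0 ?mulr0 ?subr_gt0// (lt_trans ltr01).
by rewrite !pospow_ge0E// mulr_powRB1// (lt_trans ltr01).
Qed.

Lemma pospow_cvg0 q : 0 < q -> pospow q s @[s --> (0 : R)] --> (0 : R).
Proof.
move=> q0; apply/cvgr0Pnorm_le => e e0.
have d0 : 0 < e `^ q^-1 by exact: powR_gt0.
near=> s; rewrite ger0_norm ?pospow_ge0//.
have [s0|s0] := leP s 0; first by rewrite pospow_le0// ltW.
rewrite pospow_ge0E ?(ltW s0)//.
have -> : e = (e `^ q^-1) `^ q by rewrite -powRrM mulVf ?gt_eqF// powRr1 ?ltW.
apply: (ge0_ler_powR (ltW q0)); rewrite ?nnegrE ?ltW//.
by near: s; exact: lt_nbhsl.
Unshelve. all: by end_near. Qed.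

(** The difference quotient of [s * w s] at [0] is [w] itself. *)
Lemma is_derive_mul_id (w : R -> R) : w s @[s --> (0 : R)] --> w 0 ->
  is_derive (0 : R) 1 (fun s => s * w s) (w 0).
Proof.
move=> cw.
suff cv : (fun h : R => h^-1 *: ((fun s => s * w s) (h *: 1 + 0) - 0 * w 0))
    @ 0^' --> w 0.
  by apply: DeriveDef; [exact: cvgP cv|exact: cvg_lim cv].
have cw0 : w s @[s --> (0 : R)^'] --> w 0 by exact: cvg_within_filter cw.
apply: cvg_trans cw0; apply: near_eq_cvg; near=> h.
have h0 : h != 0 by near: h; exact: nbhs_dnbhs_neq.
by rewrite /= addr0 mul0r subr0 [h *: 1]mulr1 [_ *: _]mulKf.
Unshelve. all: by end_near. Qed.

(** At the kink [s = 0], use [pospow q s = s * pospow (q - 1) s], whose second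
    factor tends to [0] because [q > 1]. *)
Lemma is_derive_pospow q s : 1 < q ->
  is_derive s 1 (pospow q) (q * pospow (q - 1) s).
Proof.
move=> q1; have q0 : 0 < q by rewrite (lt_trans ltr01).
have qB1 : 0 < q - 1 by rewrite subr_gt0.
have [s0|s0|->] := ltgtP s 0.
- rewrite pospow_le0 ?(ltW s0)// mulr0.
  apply: (@near_eq_is_derive _ _ _ (cst 0)).
  by near=> t; rewrite pospow_le0// ltW//; near: t; exact: lt_nbhsl.
- rewrite pospow_ge0E ?(ltW s0)//.
  apply: (@near_eq_is_derive _ _ _ (@powR R ^~ q)); last exact: is_derive1_powR.
  by near=> t; rewrite pospow_ge0E// ltW//; near: t; exact: lt_nbhsr.
- rewrite pospow_le0 ?mulr0//.
  rewrite (_ : pospow q = fun s => s * pospow (q - 1) s); last first.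
    by apply/funext => t; rewrite mulr_pospowB1.
  have w0 : pospow (q - 1) 0 = 0 by rewrite pospow_le0.
  by rewrite -[X in is_derive _ _ _ X]w0; apply: is_derive_mul_id;
    rewrite w0; exact: pospow_cvg0.
Unshelve. all: by end_near. Qed.

Lemma pospow_continuous q : 0 < q -> continuous (pospow q).
Proof.
move=> q0 s; have [s0|s0|->] := ltgtP s 0; rewrite /continuous_at.
- rewrite pospow_le0 ?(ltW s0)//; apply: cvg_near_cst.
  by near=> t; rewrite pospow_le0// ltW//; near: t; exact: lt_nbhsl.
- rewrite pospow_ge0E ?(ltW s0)//.
  have : {for s, continuous (@powR R ^~ q)}.
    apply/differentiable_continuous/derivable1_diffP.
    by case: (is_derive1_powR q s0).
  apply: cvg_trans; apply: near_eq_cvg.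
  by near=> t; rewrite pospow_ge0E// ltW//; near: t; exact: lt_nbhsr.
- by rewrite (pospow_le0 q0 (lexx _)); exact: pospow_cvg0.
Unshelve. all: by end_near. Qed.

Lemma is_derive_pospow_shift q (r s : R) : 1 < q ->
  is_derive s 1 (fun t => pospow q (t - r)) (q * pospow (q - 1) (s - r)).
Proof.
move=> q1; rewrite -[X in is_derive _ _ _ X]mulr1.
exact: (@is_derive1_comp _ (pospow q) (shift (- r)) s _ _
  (is_derive_pospow (s - r) q1) (is_derive_shift s 1 (- r))).
Qed.

Lemma pospow_shift_continuous q (r : R) : 0 < q ->
  continuous (fun t => pospow q (t - r)).
Proof.
move=> q0 s; apply: (@continuous_comp _ _ _ (fun t => t - r)).
  by apply: cvgB; [exact: cvg_id|exact: cvg_cst].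
exact: pospow_continuous.
Qed.

End positive_part_power.

(** * The radial profile and its derivatives *)

Section radial_stretch.
Context {R : realType}.
Implicit Types (r p s : R) (n : nat).

(** The function [a] such that [h x = (1 + a |x|) x]: the profile is
    [s * (1 + a s)], see [radial_profileE]. *)
Definition stretch r p s : R := pospow p (s - r) / s.

Definition dstretch r p s : R :=
  p * pospow (p - 1) (s - r) / s - pospow p (s - r) / s ^+ 2.

(** The derivative of the radial profile. *)
Definition slope r p s : R := 1 + p * pospow (p - 1) (s - r).

Definition dslope r p s : R := p * ((p - 1) * pospow (p - 1 - 1) (s - r)).

Lemma radial_profileE r p s : 0 < p -> 0 < s ->
  radial_profile r p s = s * (1 + stretch r p s).
Proof.
move=> p0 s0; rewrite mulrDr mulr1 /stretch mulrC divfK ?gt_eqF//.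
rewrite /radial_profile; case: ltP => sr.
  by rewrite pospow_le0 ?addr0// subr_le0 ltW.
by rewrite pospow_ge0E// subr_ge0.
Qed.

Lemma dstretch0 r p : dstretch r p 0 = 0.
Proof. by rewrite /dstretch expr0n invr0 !mulr0 subrr. Qed.

(** For [r = 0] the quotient by [s] is singular at the point where the positive
    part vanishes, so that this case is treated through a closed form. *)
Lemma stretch_origin p : 2 < p -> stretch 0 p = pospow (p - 1).
Proof.
move=> p2; apply/funext => s; rewrite /stretch subr0.
have [->|s0] := eqVneq s 0.
  by rewrite invr0 mulr0 pospow_le0//; lra.
by rewrite -(@mulr_pospowB1 _ p) ?mulKf// 1?mulrAC ?mulfV ?mul1r//; lra.
Qed.

Lemma dstretch_origin p s : 2 < p ->
  dstretch 0 p s = (p - 1) * pospow (p - 1 - 1) s.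
Proof.
move=> p2; have [->|s0] := eqVneq s 0.
  by rewrite dstretch0 pospow_le0 ?mulr0//; lra.
rewrite /dstretch subr0 -(@mulr_pospowB1 _ p); last lra.
by rewrite -(@mulr_pospowB1 _ (p - 1)); [field|lra].
Qed.

Lemma is_derive_stretch r p s : 0 <= r -> 2 < p ->
  is_derive s 1 (stretch r p) (dstretch r p s).
Proof.
move=> r0 p2; have p1 : 1 < p by lra.
have [rE|r_neq0] := eqVneq r 0.
  rewrite rE stretch_origin// dstretch_origin//.
  by apply: is_derive_pospow; lra.
have {r_neq0}r_gt0 : 0 < r by rewrite lt_def r_neq0.
have [sr|sr] := ltP s r.
  rewrite /dstretch !pospow_le0 ?subr_le0 ?(ltW sr)//; [|lra..].
  rewrite mulr0 !mul0r subr0.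
  apply: (@near_eq_is_derive _ _ _ (cst 0)).
  near=> t; rewrite /stretch pospow_le0 ?mul0r//; first lra.
  by rewrite subr_le0 ltW//; near: t; exact: lt_nbhsl.
have s0 : s != 0 by rewrite gt_eqF//; lra.
have dV : is_derive s 1 (fun t : R => t^-1) (- s ^- 2 *: 1).
  exact: (@is_deriveV _ id).
have := is_deriveM (is_derive_pospow_shift r s p1) dV.
rewrite (_ : _ * _ = stretch r p)//; move=> H; apply: (is_derive_eq H).
rewrite /dstretch /GRing.scale /=; field.
by [].
Unshelve. all: by end_near. Qed.

Lemma stretch_continuous r p : 0 <= r -> 2 < p -> continuous (stretch r p).
Proof.
move=> r0 p2 s; apply/differentiable_continuous/derivable1_diffP.
by case: (is_derive_stretch s r0 p2).
Qed.

Lemma dstretch_continuous r p : 0 <= r -> 2 < p -> continuous (dstretch r p).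
Proof.
move=> r0 p2 s; rewrite /continuous_at.
have [->|r_neq0] := eqVneq r 0.
  rewrite dstretch_origin// (funext (fun s => dstretch_origin s p2)).
  by apply: cvgM; [exact: cvg_cst|apply: pospow_continuous; lra].
have {r_neq0}r_gt0 : 0 < r by rewrite lt_def r_neq0.
have [sr|sr] := ltP s r.
  have dstretch_lt t : t < r -> dstretch r p t = 0.
    move=> tr; rewrite /dstretch !pospow_le0 ?subr_le0 ?(ltW tr)//; [|lra..].
    by rewrite mulr0 !mul0r subr0.
  rewrite dstretch_lt//; apply: cvg_near_cst; near=> t; rewrite dstretch_lt//.
  by near: t; exact: lt_nbhsl.
have s0 : s != 0 by rewrite gt_eqF//; lra.
apply: cvgB; apply: cvgM.
- apply: cvgM; first exact: cvg_cst.
  by apply: pospow_shift_continuous; lra.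
- by apply: cvgV => //; exact: cvg_id.
- by apply: pospow_shift_continuous; lra.
- by apply: cvgV; [rewrite expf_neq0|exact: exprn_continuous].
Unshelve. all: by end_near. Qed.

(** The Leibniz rule for [s * (1 + stretch r p s)]. *)
Lemma slopeE r p s : 0 <= r -> 2 < p -> 0 <= s ->
  slope r p s = 1 + stretch r p s + s * dstretch r p s.
Proof.
move=> r0 p2; rewrite le_eqVlt => /predU1P[<-|s0].
  rewrite dstretch0 mulr0 /stretch /slope invr0 mulr0.
  rewrite pospow_le0 ?mulr0 ?addr0//; first lra.
  by rewrite sub0r oppr_le0.
rewrite /slope /stretch /dstretch; field.
by rewrite gt_eqF.
Qed.

Lemma stretch_ge0 r p s : 0 <= s -> 0 <= stretch r p s.
Proof. by move=> s0; rewrite divr_ge0// pospow_ge0. Qed.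

Lemma slope_ge1 r p s : 0 <= p -> 1 <= slope r p s.
Proof. by move=> p0; rewrite lerDl mulr_ge0// pospow_ge0. Qed.

Lemma dstretch_ge0 r p s : 0 <= r -> 2 < p -> 0 <= s -> 0 <= dstretch r p s.
Proof.
move=> r0 p2; rewrite le_eqVlt => /predU1P[<-|s0]; first by rewrite dstretch0.
rewrite (_ : dstretch r p s =
    (p * s - (s - r)) * pospow (p - 1) (s - r) / s ^+ 2).
  by rewrite divr_ge0 ?sqr_ge0// mulr_ge0 ?pospow_ge0//; nra.
rewrite /dstretch -(@mulr_pospowB1 _ p); last lra.
by field; rewrite gt_eqF.
Qed.

Lemma is_derive_slope r p s : 2 < p ->
  is_derive s 1 (slope r p) (dslope r p s).
Proof.
move=> p2; have p1 : 1 < p - 1 by lra.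
have := is_deriveD (is_derive_cst (1 : R) s 1)
  (is_deriveZ p (is_derive_pospow_shift r s p1)).
by rewrite add0r.
Qed.

(** The Jacobian determinant of the radial map at distance [s] from the origin,
    in dimension [n.+1]. *)
Definition radial_det r p n s : R := (1 + stretch r p s) ^+ n * slope r p s.

Definition dradial_det r p n s : R :=
  n%:R * (1 + stretch r p s) ^+ n.-1 * dstretch r p s * slope r p s +
  (1 + stretch r p s) ^+ n * dslope r p s.

Lemma is_derive_radial_det r p n s : 0 <= r -> 2 < p ->
  is_derive s 1 (radial_det r p n) (dradial_det r p n s).
Proof.
move=> r0 p2.
have d1 := is_deriveD (is_derive_cst (1 : R) s 1) (is_derive_stretch s r0 p2).
have := is_deriveM (is_deriveX n d1) (is_derive_slope r s p2).
rewrite (_ : _ * _ = radial_det r p n); last first.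
  by apply/funext => t; rewrite /radial_det !fctE.
move=> H; apply: (is_derive_eq H).
by rewrite /dradial_det /GRing.scale /= !fctE add0r; ring.
Qed.

Lemma dradial_det_continuous r p n : 0 <= r -> 2 < p ->
  continuous (dradial_det r p n).
Proof.
move=> r0 p2 s.
have cstretch m : (1 + stretch r p t) ^+ m @[t --> s] -->
    (1 + stretch r p s) ^+ m.
  apply: (@continuous_comp _ _ _ (fun t => 1 + stretch r p t)
    (fun t => t ^+ m)).
    by apply: cvgD; [exact: cvg_cst|exact: stretch_continuous].
  exact: exprn_continuous.
apply: cvgD; apply: cvgM => //.
- apply: cvgM; last exact: dstretch_continuous.
  by apply: cvgM => //; exact: cvg_cst.
- apply: cvgD; first exact: cvg_cst.
  by apply: cvgM; [exact: cvg_cst|apply: pospow_shift_continuous; lra].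
- apply: cvgM; first exact: cvg_cst.
  by apply: cvgM; [exact: cvg_cst|apply: pospow_shift_continuous; lra].
Qed.

Lemma dradial_det0 r p n : 0 <= r -> 2 < p -> dradial_det r p n 0 = 0.
Proof.
move=> r0 p2; rewrite /dradial_det dstretch0 mulr0 mul0r add0r /dslope.
by rewrite pospow_le0 ?mulr0//; lra.
Qed.

Lemma radial_det_gt0 r p n s : 0 <= p -> 0 <= s -> 0 < radial_det r p n s.
Proof.
move=> p0 s0; apply: mulr_gt0.
  by rewrite exprn_gt0// ltr_pwDl// stretch_ge0.
by rewrite (lt_le_trans ltr01)// slope_ge1.
Qed.

Lemma dradial_det_ge0 r p n s : 0 <= r -> 2 < p -> 0 <= s ->
  0 <= dradial_det r p n s.
Proof.
move=> r0 p2 s0.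
have c0 : 0 <= 1 + stretch r p s by rewrite addr_ge0// stretch_ge0.
have sl1 := @slope_ge1 r p s.
rewrite addr_ge0// mulr_ge0 ?exprn_ge0//.
- by rewrite mulr_ge0 ?dstretch_ge0// mulr_ge0 ?exprn_ge0.
- by rewrite (le_trans ler01)// sl1; lra.
- by rewrite mulr_ge0 ?mulr_ge0 ?pospow_ge0//; lra.
Qed.

(** Far from the origin the logarithmic derivative of the Jacobian is negligible
    with respect to the slope [f'].  The factor [(1 + a) ^ n] contributes
    [n a' / (1 + a) <= n a' <= n f' / s], as [f' = 1 + a + s a'].  The factor
    [f'] contributes [f'' / f' <= f''], and [f''] equals [(p - 1) / (s - r)]
    times [f' - 1]. *)
Lemma dradial_det_le r p n s : 0 <= r -> 2 < p -> r < s ->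
  dradial_det r p n s <=
  (n%:R + p) / (s - r) * (radial_det r p n s * slope r p s).
Proof.
move=> r0 p2 sr; have s0 : 0 < s by lra.
have t0 : 0 < s - r by lra.
rewrite /dradial_det /radial_det.
set c := 1 + stretch r p s; set f := slope r p s.
have c1 : 1 <= c by rewrite lerDl stretch_ge0// ltW.
have f1 : 1 <= f by apply: slope_ge1; lra.
have cn0 : 0 <= c ^+ n by rewrite exprn_ge0//; lra.
have H1 : dstretch r p s <= (s - r)^-1 * f.
  rewrite ler_pdivlMl//; apply: (@le_trans _ _ (s * dstretch r p s)).
    by rewrite ler_wpM2r ?dstretch_ge0 ?(ltW s0)//; lra.
  by rewrite /f (@slopeE r p s) ?(ltW s0)// lerDr -/c; lra.
have H2 : dslope r p s <= p * ((s - r)^-1 * f).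
  rewrite /dslope; set a := pospow (p - 1 - 1) (s - r).
  have a0 : 0 <= a by exact: pospow_ge0.
  rewrite ler_pM2l; last lra.
  rewrite ler_pdivlMl// /f /slope -(@mulr_pospowB1 _ (p - 1)) -/a; last by lra.
  have : 0 <= (s - r) * a by rewrite mulr_ge0// ltW.
  nra.
have H3 : c ^+ n.-1 <= c ^+ n by rewrite ler_weXn2l// leq_pred.
have u0 : 0 <= (s - r)^-1 * f by rewrite mulr_ge0 ?invr_ge0 ?(ltW t0)//; lra.
have d0 : 0 <= dstretch r p s by rewrite dstretch_ge0 ?(ltW s0).
set u := (s - r)^-1 * f in H1 H2 u0.
have -> : (n%:R + p) / (s - r) * (c ^+ n * f * f) =
    n%:R * (c ^+ n * u) * f + c ^+ n * (p * u) * f by rewrite /u; ring.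
apply: lerD.
  rewrite ler_wpM2r ?(le_trans ler01 f1)// -mulrA ler_wpM2l//.
  rewrite ler_pM// exprn_ge0//; lra.
rewrite -[leLHS]mulr1; apply: ler_pM => //.
  by rewrite mulr_ge0// /dslope !mulr_ge0 ?pospow_ge0//; lra.
by rewrite ler_wpM2l.
Qed.

End radial_stretch.

(** * The transformed density *)

Section transformed_density.
Context {R : realType} {k : nat}.
Implicit Types (x : 'rV[R]_k) (r p : R).

Lemma limf_esup_enorm_lt0 (f : 'rV[R]_k -> R) :
  (limf_esup (fun x => (f x)%:E) enorm_pinfty < 0)%E <->
  exists r e : R, 0 < e /\ forall x, r < enorm x -> f x <= - e.
Proof.
split=> [|[r [e [e0 fe]]]].
  move=> /ereal_inf_lt[_ [V [r _ rV] <-]] supV0.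
  have fsup x : r < enorm x ->
      ((f x)%:E <= ereal_sup [set (f y)%:E | y in V])%E.
    by move=> rx; apply: ereal_sup_ubound; exists x => //; exact: rV.
  move: supV0 fsup; case: (ereal_sup _) => [y| |] //.
    rewrite lte_fin => y0 fy; exists r, (- y); split; first by rewrite oppr_gt0.
    by move=> x /fy; rewrite lee_fin opprK.
  (* The supremum is -oo, hence nothing lies beyond r. *)
  move=> _ fy; exists r, 1; split => // x /fy.
  by rewrite leeNy_eq.
apply: (@le_lt_trans _ _ (- e)%:E); last by rewrite lte_fin oppr_lt0.
apply: (@le_trans _ _ (ereal_sup [set (f y)%:E | y in [set y | r < enorm y]])).
  by apply: ereal_inf_lbound; exists [set y | r < enorm y] => //; exists r.
by apply: ge_ereal_sup => _ [x /= rx <-]; rewrite lee_fin fe.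
Qed.

(** The vector [N] has the shape of the gradient of the transformed density at
    [x], with [G] and [P] the gradient and the value of the original density at
    [h x].  With [X = D * f * enorm G], the summand with factor [D] has radial
    part at most [- delta * X] and norm at most [X]; the bound on [dD] is chosen
    so that [P * dD <= delta / 2 * X], using [eps * P <= enorm G].  The ratio
    is therefore at most [- (delta / 2) / (1 + delta / 2)]. *)
Lemma radial_curvature_le (x G : 'rV[R]_k) (c da f P D dD eps delta : R)
    (N := P *: ((dD / enorm x) *: x) +
      D *: (c *: G + dotp x G *: ((da / enorm x) *: x))) :
  x != 0 -> 0 < eps -> 0 < delta -> 0 < P -> 0 < D -> 0 < c ->
  f = c + enorm x * da -> 0 <= da -> 0 <= dD ->
  dD <= delta * eps / 2 * (D * f) ->
  dotp ((enorm x)^-1 *: x) G <= - (eps * P) ->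
  dotp ((enorm x)^-1 *: x) G <= - (delta * enorm G) ->
  dotp ((enorm x)^-1 *: x) ((enorm N)^-1 *: N) <= - (delta / (2 + delta)).
Proof.
move=> x0 e0 d0 P0 D0 c0 fE da0 dD0 dD_le g_eps g_delta.
have s0 : 0 < enorm x by rewrite enorm_gt0.
set s := enorm x in N fE g_eps g_delta s0 *.
set u := s^-1 *: x in g_eps g_delta *.
have u1 : enorm u = 1 by rewrite enormZ gtr0_norm ?invr_gt0// mulVf// gt_eqF.
have xE : x = s *: u by rewrite scalerA mulfV ?scale1r// gt_eqF.
set g := dotp u G in g_eps g_delta.
have NE : N = (D * c) *: G + (D * (f - c) * g + P * dD) *: u.
  have xs a : (a / s) *: x = a *: u by rewrite /u scalerA.
  have xG : dotp x G = s * g by rewrite [in LHS]xE dotpZl.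
  rewrite /N !xs xG scalerDr !scalerA addrCA -scalerDl; congr (_ + _ *: _).
  by rewrite fE; ring.
have uu : dotp u u = 1 by rewrite dotpxx u1 expr1n.
have uN : dotp u N = D * f * g + P * dD.
  by rewrite NE dotpDr (dotpZr (D * c)) (dotpZr (_ + _)) uu -/g; ring.
have g_le : `|g| <= enorm G.
  by rewrite (le_trans (dotp_le_enorm _ _))// u1 mul1r.
have cf : c <= f by rewrite fE lerDl mulr_ge0// ltW.
have f_gt0 : 0 < f by lra.
have g_lt0 : g < 0 by rewrite (le_lt_trans g_eps)// oppr_lt0 mulr_gt0.
have gE : `|g| = - g by rewrite ltr0_norm.
set X := D * f * enorm G.
have Df0 : 0 < D * f by rewrite mulr_gt0.
have X0 : 0 < X by rewrite mulr_gt0//; lra.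
have PdD : P * dD <= delta / 2 * X.
  apply: (@le_trans _ _ (P * (delta * eps / 2 * (D * f)))).
    by rewrite ler_wpM2l// ltW.
  rewrite (_ : P * _ = (eps * P) * (delta / 2 * (D * f))); last by ring.
  rewrite (_ : delta / 2 * X = enorm G * (delta / 2 * (D * f))); last first.
    by rewrite /X; ring.
  by rewrite ler_wpM2r; [|rewrite mulr_ge0 ?divr_ge0 ?ltW|lra].
have uN_le : dotp u N <= - (delta / 2 * X).
  have : D * f * g <= D * f * - (delta * enorm G) by rewrite ler_wpM2l// ltW.
  rewrite uN (_ : D * f * - (delta * enorm G) = - (delta * X)); last first.
    by rewrite /X; ring.
  lra.
have N_le : enorm N <= (1 + delta / 2) * X.
  rewrite NE (le_trans (enormD _ _))// (enormZ (D * c)) (enormZ (_ + _)).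
  rewrite u1 mulr1.
  rewrite gtr0_norm ?mulr_gt0//.
  have H1 : `|D * (f - c) * g + P * dD| <=
      D * (f - c) * enorm G + delta / 2 * X.
    rewrite (le_trans (ler_normD _ _))// lerD//.
      rewrite normrM ger0_norm ?mulr_ge0 ?subr_ge0 ?(ltW D0)//.
      by rewrite ler_wpM2l// mulr_ge0 ?subr_ge0 ?(ltW D0).
    by rewrite ger0_norm// mulr_ge0// ltW.
  rewrite (_ : (1 + delta / 2) * X = D * c * enorm G +
    (D * (f - c) * enorm G + delta / 2 * X)); last by rewrite /X; ring.
  by rewrite lerD2l.
have N0 : 0 < enorm N.
  rewrite enorm_gt0; apply: contraTneq uN_le => ->.
  by rewrite dotp0r -ltNge oppr_lt0 mulr_gt0// divr_gt0.
rewrite dotpZr ler_pdivrMl// mulrN.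
apply: (le_trans uN_le); rewrite lerN2.
have -> : delta / 2 * X = (1 + delta / 2) * X * (delta / (2 + delta)).
  by field; lra.
by rewrite ler_wpM2r// divr_ge0//; lra.
Qed.

Section radial.
Context (r p : R) (r0 : 0 <= r) (p2 : 2 < p).

Lemma radial_mapE_stretch x :
  radial_map (radial_profile r p) x = (1 + stretch r p (enorm x)) *: x.
Proof.
rewrite radial_mapE; have [->|x0] := eqVneq x 0; first by rewrite !scaler0.
have s0 : 0 < enorm x by rewrite enorm_gt0.
rewrite radial_profileE ?(lt_trans _ p2)//.
by rewrite mulrAC mulfV ?mul1r// gt_eqF.
Qed.

Lemma has_grad_stretch x :
  has_grad (fun x => 1 + stretch r p (enorm x)) x (radial_map (dstretch r p) x).
Proof.
apply: (@has_grad_radial _ _ (fun s => 1 + stretch r p s)).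
  have := is_deriveD (is_derive_cst (1 : R) (enorm x) 1)
    (is_derive_stretch (enorm x) r0 p2).
  by rewrite add0r.
exact: dstretch0.
Qed.

(** With [c = 1 + a s], the Jacobian matrix is [c] times the identity plus a
    rank one matrix of trace [s * a' s], and [c + s * a' s] is the slope at
    [s]. *)
Lemma det_jacobian_radial x : (0 < k)%N ->
  \det ('J (radial_map (radial_profile r p)) x) = radial_det r p k.-1 (enorm x).
Proof.
move=> k0; rewrite (funext radial_mapE_stretch).
have c0 : 1 + stretch r p (enorm x) != 0.
  by rewrite gt_eqF// ltr_pwDl// stretch_ge0// enorm_ge0.
rewrite (jacobian_scale_id (has_grad_stretch x)) det_scalar_add_rank1//.
rewrite /radial_det slopeE ?enorm_ge0//; congr (_ * (_ + _)).
have -> : (x *m (radial_map (dstretch r p) x)^T) 0 0 =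
    dotp x (radial_map (dstretch r p) x).
  by rewrite mxE; apply: eq_bigr => i _; rewrite mxE.
rewrite radial_mapE dotpZr dotpxx.
have [->|x0] := eqVneq x 0; first by rewrite enorm0 expr0n mulr0 mul0r.
by field; rewrite enorm_eq0.
Qed.

Lemma transformed_densityE (g : 'rV[R]_k -> R) : (0 < k)%N ->
  transformed_density (radial_map (radial_profile r p)) g =
  (fun x => g ((1 + stretch r p (enorm x)) *: x)) *
  (radial_det r p k.-1 \o @enorm R k).
Proof.
have p0 : 0 <= p by rewrite ltW// (lt_trans _ p2).
move=> k0; apply/funext => x.
rewrite /transformed_density det_jacobian_radial// radial_mapE_stretch.
by rewrite gtr0_norm// radial_det_gt0// enorm_ge0.
Qed.

Lemma has_grad_transformed_density (g : 'rV[R]_k -> R) x :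
  (0 < k)%N -> continuously_differentiable g ->
  let h := radial_map (radial_profile r p) in
  has_grad (transformed_density h g) x
   (g (h x) *: radial_map (dradial_det r p k.-1) x +
    radial_det r p k.-1 (enorm x) *:
      ((1 + stretch r p (enorm x)) *: grad g (h x) +
       dotp x (grad g (h x)) *: radial_map (dstretch r p) x)).
Proof.
move=> k0 [dg _] h; rewrite transformed_densityE// /h radial_mapE_stretch.
apply: has_gradM.
  apply: (has_grad_comp_scale_id (has_grad_stretch x)).
  exact: differentiable_has_grad.
apply: has_grad_radial; first exact: is_derive_radial_det.
exact: dradial_det0.
Qed.

Lemma continuously_differentiable_transformed_density (g : 'rV[R]_k -> R) :
  (0 < k)%N -> continuously_differentiable g ->
  continuously_differentiable
    (transformed_density (radial_map (radial_profile r p)) g).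
Proof.
move=> k0 g1; apply: continuously_differentiable_has_grad => [x|].
  exact: has_grad_transformed_density.
have [dg cg] := g1.
set h := radial_map _.
have cc : continuous (fun x : 'rV[R]_k => 1 + stretch r p (enorm x)).
  move=> x; apply/differentiable_continuous.
  exact: has_grad_differentiable (has_grad_stretch x).
have ch : continuous h.
  move=> x; have Fx := nbhs_filter x.
  rewrite /h (funext radial_mapE_stretch).
  by apply: cvgZ; [exact: cc|exact: cvg_id].
have cGh : continuous (grad g \o h).
  by move=> x; exact: (continuous_comp (ch x) (cg (h x))).
have cdet : continuous (radial_det r p k.-1 \o @enorm R k).
  move=> x; apply/differentiable_continuous; apply: has_grad_differentiable.
  apply: has_grad_radial; first exact: is_derive_radial_det.
  exact: dradial_det0.
move=> x; have Fx := nbhs_filter x.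
apply: cvgD; apply: cvgZ.
- exact: (continuous_comp (ch x) (differentiable_continuous (dg (h x)))).
- apply: radial_map_continuous; first exact: dradial_det_continuous.
  exact: dradial_det0.
- exact: cdet.
- apply: cvgD; apply: cvgZ.
  + exact: cc.
  + exact: cGh.
  + by apply: (@dotp_continuous _ _ id (grad g \o h)) => // y; exact: cvg_id.
  + apply: radial_map_continuous; first exact: dstretch_continuous.
    exact: dstretch0.
Qed.

End radial.
End transformed_density.

(** * Behaviour at infinity *)

Section conditions_at_infinity.
Context {R : realType} {k : nat}.

Lemma grad_ln (g : 'rV[R]_k -> R) x : 0 < g x -> differentiable g x ->
  grad (@ln R \o g) x = (g x)^-1 *: grad g x.
Proof.
move=> g0 dg; apply: has_gradE; apply: has_grad_comp1.
  exact: is_derive1_ln.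
exact: differentiable_has_grad.
Qed.

Lemma exponentially_light_radial (g : 'rV[R]_k -> R) :
  (forall x, 0 < g x) -> (forall x, differentiable g x) ->
  exponentially_light g ->
  exists r e : R, 0 < e /\ forall x, r < enorm x ->
    dotp ((enorm x)^-1 *: x) (grad g x) <= - (e * g x).
Proof.
move=> g0 dg /limf_esup_enorm_lt0[r [e [e0 ge]]]; exists r, e; split=> // x /ge.
by rewrite grad_ln// dotpZr ler_pdivrMl// mulrN mulrC.
Qed.

(** Multiplying by [enorm (grad g x)] removes the degenerate case of a vanishing
    gradient, where both sides are [0]. *)
Lemma curvature_condition_radial (g : 'rV[R]_k -> R) :
  curvature_condition g ->
  exists r d : R, 0 < d /\ forall x, r < enorm x ->
    dotp ((enorm x)^-1 *: x) (grad g x) <= - (d * enorm (grad g x)).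
Proof.
move=> /limf_esup_enorm_lt0[r [d [d0 gd]]]; exists r, d; split=> // x /gd.
have [->|gx0] := eqVneq (grad g x) 0.
  by rewrite scaler0 dotp0r enorm0 mulr0 oppr0.
by rewrite dotpZr ler_pdivrMl ?enorm_gt0// mulrN mulrC.
Qed.

(** Lightness and [enorm (grad g x) <= M * g x] together give the conclusion of
    [curvature_condition_radial], with constant [e / M]. *)
Lemma log_gradient_bounded_radial (g : 'rV[R]_k -> R) :
  (forall x, 0 < g x) -> (forall x, differentiable g x) ->
  exponentially_light g -> log_gradient_bounded_at_infinity g ->
  exists r d : R, 0 < d /\ forall x, r < enorm x ->
    dotp ((enorm x)^-1 *: x) (grad g x) <= - (d * enorm (grad g x)).
Proof.
move=> g0 dg /(exponentially_light_radial g0 dg)[r1 [e [e0 ge]]] [M [r2 gM]].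
(* M may be nonpositive, while the new constant divides by a bound. *)
exists (Num.max r1 r2), (e / (`|M| + 1)); split.
  by rewrite divr_gt0// ltr_wpDl.
move=> x; rewrite gt_max => /andP[/ge + /gM].
rewrite grad_ln// enormZ gtr0_norm ?invr_gt0// ler_pdivrMl// => + le_M.
move=> /le_trans; apply; rewrite lerN2 -mulrA ler_wpM2l ?(ltW e0)//.
rewrite ler_pdivrMl ?ltr_wpDl// mulrC (le_trans le_M)//.
rewrite ler_wpM2l ?(ltW (g0 x))//.
by rewrite (le_trans (ler_norm _))// lerDl.
Qed.

End conditions_at_infinity.

Theorem theorem4 (R : realType) (k : nat) (hk : (0 < k)%N)
    (pi_beta : 'rV[R]_k -> R)
    (pi_beta_density : is_density pi_beta)
    (pi_beta_gt0 : forall x, 0 < pi_beta x)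
    (pi_beta_C1 : continuously_differentiable pi_beta)
    (pi_beta_light : exponentially_light pi_beta)
    (pi_beta_cond : curvature_condition pi_beta \/
       log_gradient_bounded_at_infinity pi_beta)
    (R0 p : R) (hR0 : 0 <= R0) (hp : 2 < p) :
  let h : 'rV[R]_k -> 'rV[R]_k := radial_map (radial_profile R0 p) in
  let pi_gamma := transformed_density h pi_beta in
  [/\ forall x, 0 < pi_gamma x,
      continuously_differentiable pi_gamma &
      curvature_condition pi_gamma].
Proof.
move=> h pi_gamma; have p0 : 0 <= p by lra.
have [dpi _] := pi_beta_C1.
have hE x : h x = (1 + stretch R0 p (enorm x)) *: x.
  exact: radial_mapE_stretch.
split.
- move=> x; rewrite /pi_gamma transformed_densityE// mulr_gt0//=.
  by rewrite radial_det_gt0 ?enorm_ge0.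
- exact: continuously_differentiable_transformed_density.
have [r1 [e [e0 light]]] :=
  exponentially_light_radial pi_beta_gt0 dpi pi_beta_light.
have [r2 [d [d0 curved]]] : exists r d : R, 0 < d /\ forall x, r < enorm x ->
    dotp ((enorm x)^-1 *: x) (grad pi_beta x) <= - (d * enorm (grad pi_beta x)).
  case: pi_beta_cond; first exact: curvature_condition_radial.
  exact: log_gradient_bounded_radial.
(* Beyond R0 + K the bound of dradial_det_le is at most d * e / 2. *)
pose K : R := (k.-1%:R + p) / (d * e / 2).
apply/limf_esup_enorm_lt0.
exists (Num.max (Num.max r1 r2) (R0 + K)), (d / (2 + d)); split.
  by rewrite divr_gt0// addr_gt0.
move=> x; rewrite !gt_max => /andP[/andP[r1x r2x] Kx].
have de0 : 0 < d * e / 2 by rewrite divr_gt0// mulr_gt0.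
have k0 : 0 <= k.-1%:R + p by rewrite addr_ge0.
have K0 : 0 <= K by rewrite divr_ge0// ltW.
have s0 : 0 < enorm x by lra.
have c1 : 1 <= 1 + stretch R0 p (enorm x) by rewrite lerDl stretch_ge0// ltW.
have c0 : 0 < 1 + stretch R0 p (enorm x) by rewrite (lt_le_trans ltr01).
have enorm_h : enorm (h x) = (1 + stretch R0 p (enorm x)) * enorm x.
  by rewrite hE enormZ gtr0_norm.
have h_far : enorm x <= enorm (h x) by rewrite enorm_h ler_peMl// ltW.
have h_dir : (enorm x)^-1 *: x = (enorm (h x))^-1 *: h x.
  by rewrite enorm_h hE scalerA invfM mulrAC mulVf ?mul1r// gt_eqF.
have := has_grad_transformed_density hR0 hp x hk pi_beta_C1.
move=> /has_gradE; rewrite -/h -/pi_gamma => ->.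
rewrite !(radial_mapE (dradial_det _ _ _)) !(radial_mapE (dstretch _ _)).
apply: (@radial_curvature_le _ _ _ _ _ _ (slope R0 p (enorm x)) _ _ _ e) => //.
- by rewrite -enorm_gt0.
- by rewrite radial_det_gt0// ltW.
- by rewrite slopeE// ltW.
- by rewrite dstretch_ge0// ltW.
- by rewrite dradial_det_ge0// ltW.
- apply: le_trans (dradial_det_le _ hR0 hp _) _; first lra.
  rewrite ler_wpM2r//.
    rewrite mulr_ge0 ?(le_trans ler01 (slope_ge1 _ _ p0))//.
    by rewrite ltW// radial_det_gt0// ltW.
  rewrite ler_pdivrMr; last lra.
  by rewrite -ler_pdivrMl// mulrC -/K; lra.
- by rewrite h_dir light// (lt_le_trans r1x).
- by rewrite h_dir curved// (lt_le_trans r2x).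
Qed.
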